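(* For any non-negative integer $n$ we have $$a^e_\nu(n)=a^o_\nu(n)+e(n),$$ where $$e(n)=\begin{cases}1,&\text{if } n=3j^2+2j\text{ for some integer } j\ge 0,\\-1,&\text{if } n=3j^2+4j+1\text{ for some integer } j\ge 0,\\0,&\text{otherwise.}\end{cases}$$
   Context: A partition of $n$ is a finite non-increasing sequence of positive integers (parts) with sum $n$; the empty partition is the only partition of $0$ and has $0$ parts. $\mathcal A_\nu(n)$ is the set of partitions of $n$ whose even parts are distinct and such that, if $m$ occurs as a part, then so does every positive even number less than $m$. $a^e_\nu(n)$ (resp. $a^o_\nu(n)$) is the number of partitions in $\mathcal A_\nu(n)$ with an even (resp. odd) number of parts, counted with multiplicity. *)

(* Defs.v *)
From mathcomp Require Import all_boot all_order all_algebra.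

Set Implicit Arguments.
Unset Strict Implicit.
Unset Printing Implicit Defensive.

Definition is_partition (n : nat) (s : seq nat) : bool :=
  [&& sorted geq s, all (fun m => 0 < m) s & sumn s == n].

Definition even_parts_distinct (s : seq nat) : bool :=
  uniq [seq m <- s | ~~ odd m].

Definition smaller_evens_occur (s : seq nat) : bool :=
  all (fun m => [forall k : 'I_m, (0 < k) && ~~ odd k ==> (val k \in s)]) s.

(* A partition of n has at most n parts, each at most n, so partitions of n   *)
(* are represented in the finite type of sequences of length at most n over   *)
(* {0, ..., n}; partition_bseq shows that none is lost.                       *)
Definition parts (n : nat) (p : n.-bseq 'I_n.+1) : seq nat := map val p.

Definition A_nu (n : nat) : {set n.-bseq 'I_n.+1} :=
  [set p | [&& is_partition n (parts p), even_parts_distinct (parts p)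
             & smaller_evens_occur (parts p)]].

Definition a_nu_even (n : nat) : nat := #|[set p in A_nu n | ~~ odd (size p)]|.

Definition a_nu_odd (n : nat) : nat := #|[set p in A_nu n | odd (size p)]|.

(* The bound j <= n loses nothing: see e_plusP and e_minusP.                  *)
Definition e_plus (n : nat) : bool :=
  [exists j : 'I_n.+1, n == 3 * j ^ 2 + 2 * j].

Definition e_minus (n : nat) : bool :=
  [exists j : 'I_n.+1, n == 3 * j ^ 2 + 4 * j + 1].

Definition e (n : nat) : int :=
  if e_plus n then 1%R else if e_minus n then (-1)%R else 0%R.

Lemma parts_inj n : injective (@parts n).
Proof. by move=> p q /(inj_map val_inj) /val_inj. Qed.

Lemma partition_bseq n s :
  is_partition n s -> exists p : n.-bseq 'I_n.+1, parts p = s.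
Proof.
case/and3P=> _ s_gt0 /eqP sum_s.
have size_le : size s <= n.
  rewrite -sum_s; elim: s s_gt0 {sum_s} => //= m s IHs /andP[m_gt0 /IHs le_s].
  by rewrite -add1n leq_add.
have part_le m : m \in s -> m < n.+1.
  rewrite ltnS -sum_s; elim: s {s_gt0 sum_s size_le} => //= k s IHs.
  rewrite inE => /orP[/eqP-> | /IHs le_m]; first exact: leq_addr.
  exact: leq_trans le_m (leq_addl _ _).
have size_p : size [seq inord m : 'I_n.+1 | m <- s] <= n by rewrite size_map.
exists (Bseq size_p); rewrite /parts /= -map_comp -[RHS]map_id.
by apply/eq_in_map => m /part_le m_le; rewrite /= inordK.
Qed.

Lemma e_plusP n : reflect (exists j, n = 3 * j ^ 2 + 2 * j) (e_plus n).
Proof.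
apply: (iffP existsP) => [[j /eqP] | [j def_n]]; first by exists j.
have j_le : j < n.+1.
  by rewrite ltnS def_n (leq_trans _ (leq_addl _ _)) // leq_pmull.
by exists (Ordinal j_le); apply/eqP.
Qed.

Lemma e_minusP n : reflect (exists j, n = 3 * j ^ 2 + 4 * j + 1) (e_minus n).
Proof.
apply: (iffP existsP) => [[j /eqP] | [j def_n]]; first by exists j.
have j_le : j < n.+1.
  rewrite ltnS def_n (leq_trans _ (leq_addr _ _)) //.
  by rewrite (leq_trans _ (leq_addl _ _)) // leq_pmull.
by exists (Ordinal j_le); apply/eqP.
Qed.

Lemma smaller_evens_occurP s :
  reflect (forall m k, m \in s -> 0 < k -> ~~ odd k -> k < m -> k \in s)
          (smaller_evens_occur s).
Proof.
apply: (iffP allP) => [evens m k ms k_gt0 k_even k_lt | evens m ms].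
  by have /forallP/(_ (Ordinal k_lt))/implyP := evens m ms; apply; apply/andP.
apply/forallP => k; apply/implyP => /andP[k_gt0 k_even].
exact: evens ms k_gt0 k_even (ltn_ord k).
Qed.

(* Main.v *)
Require Import Defs.
From mathcomp Require Import all_boot all_order all_algebra.
From mathcomp Require Import zify ring.

Set Implicit Arguments.
Unset Strict Implicit.
Unset Printing Implicit Defensive.

Import GRing.Theory.

(** Write [q] for the variable. A partition of the kind counted here has even
    parts exactly [2, 4, ..., 2k] for some [k], and then any multiset of odd
    parts at most [2k+1]. Give each odd part weight 1 and each even part
    weight 2. The proof computes, for every weight [d], the polynomial
    [W_d] = sum of [(-1)^(number of parts) q^(sum of parts)] over the
    partitions of weight [d], and finds that it is zero or plus or minus a
    single power of [q]; the claim is then read off coefficientwise. In terms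
    of the generating function with [x] marking the weight,

    [f(x) = sum_k (-1)^k x^(2k) q^(k(k+1)) / ((1+xq)(1+xq^3)...(1+xq^(2k+1)))],

    this amounts to the functional equation
    [f(x) = 1 - xq + x^3 q^5 f(x q^2)], a limiting case of the Rogers-Fine
    identity.

    The recurrence [W_(d+3) = q^(2d+5) W_d] ([sum_nu_term_rec]) has the
    following combinatorial content. Let [2k] be the largest even part of a
    partition, with [k = 0] if there is none. If [2k+1] and [1] occur as two
    different parts, replace them by the new even part [2k+2]; if [2k+1] does
    not occur and [k > 0], undo this by splitting [2k] into [2k-1] and [1].
    Sum and weight are preserved and the number of parts changes parity, so
    all these partitions cancel. What survives when the weight is at least 3
    contains [2k+1] but not [1], and has [k > 0]: deleting [2k] and one [2k+1]
    and lowering every other odd part by 2 gives an arbitrary partition of the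
    same kind of weight [d], with two parts fewer. The starting values are
    [W_0 = 1], [W_1 = -q] and [W_2 = q^2 - q^2 = 0], so [W_(3j)] is
    [q^(3j^2+2j)], [W_(3j+1)] is [-q^(3j^2+4j+1)] and [W_(3j+2)] vanishes
    ([sum_nu_term]).

    Algebraically the cancellation is a telescoping sum over [k]
    ([nu_term_rec]), and rests on the two recurrences of the generating
    polynomial of odd parts, by largest part ([odd_gf_largest]) and by
    smallest part ([odd_gf_smallest]). The dictionary between partitions and
    pairs of [k] and a list of odd parts is [card_nu_class]. *)

(** * Lists of odd parts *)

Lemma gtn_trans : transitive gtn.
Proof. by move=> a b c /= ab ca; apply: ltn_trans ca ab. Qed.

Lemma geq_trans : transitive geq.
Proof. by move=> a b c /= ab ca; apply: leq_trans ca ab. Qed.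

Lemma geq_total : total geq.
Proof. by move=> a b; apply: leq_total. Qed.

Lemma geq_anti : antisymmetric geq.
Proof. by move=> a b /= ab; apply/eqP; rewrite eqn_leq andbC. Qed.

(** The non-increasing lists of [m] odd numbers below [2K]. Bounding by the
    number [K] of available parts, instead of by the largest one, makes both
    recurrences below hold from [K = 0] on. *)
Fixpoint odd_lists K : nat -> seq (seq nat) :=
  fix lists m :=
    if m is m'.+1 then
      if K is K'.+1 then
        odd_lists K' m ++ [seq K'.*2.+1 :: o | o <- lists m']
      else [::]
    else [:: [::]].

Lemma odd_listsSS K m :
  odd_lists K.+1 m.+1 =
    odd_lists K m.+1 ++ [seq K.*2.+1 :: o | o <- odd_lists K.+1 m].
Proof. by []. Qed.

Lemma odd_lists0 K : odd_lists K 0 = [:: [::]]. Proof. by case: K. Qed.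

Lemma mem_odd_lists K m o :
  (o \in odd_lists K m) =
    [&& sorted geq o, all odd o, all (fun x => x < K.*2) o & size o == m].
Proof.
elim: K m o => [|K IHK] m o.
  by case: m => [|m] /=; case: o => [|x o] //=; rewrite !andbF.
elim: m o => [|m IHm] o.
  by rewrite odd_lists0 inE; case: o => //= x o; rewrite !andbF.
rewrite odd_listsSS mem_cat IHK; case: o => [|x o].
  by apply/mapP=> -[].
have -> : (x :: o \in [seq K.*2.+1 :: o0 | o0 <- odd_lists K.+1 m])
    = (x == K.*2.+1) && (o \in odd_lists K.+1 m).
  apply/mapP/andP => [[o' o'L [-> ->]]|[/eqP-> oL]]; last by exists o.
  by rewrite eqxx.
rewrite IHm /= eqSS.
rewrite !(path_sortedE geq_trans).
case: (sorted geq o); rewrite ?andbF //=.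
case: (all odd o); rewrite ?andbF //=.
case: (size o == m); rewrite ?andbF // !andbT.
apply/idP/idP.
  case/orP=> [/and4P[-> -> xlt olt]|/andP[/eqP-> olt]].
    rewrite (leq_trans xlt) /=; last by lia.
    by apply: sub_all olt => y /=; lia.
  by apply/and4P; split=> //; lia.
case/and4P=> gx oddx xlt olt.
case: (x =P K.*2.+1) => [//|/eqP xne]; first by rewrite olt orbT.
have xlt' : x < K.*2 by lia.
rewrite /= orbF gx oddx xlt' /=.
by apply: sub_all gx => y /= yx; apply: leq_ltn_trans yx xlt'.
Qed.

Lemma odd_lists_uniq K m : uniq (odd_lists K m).
Proof.
elim: K m => [|K IHK]; first by case.
elim=> [|m IHm]; first by rewrite odd_lists0.
rewrite odd_listsSS cat_uniq IHK map_inj_uniq ?IHm; last by move=> o o' [].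
rewrite andbT; apply/hasPn=> _ /mapP[o _ ->].
by rewrite mem_odd_lists /= !negb_and -!leqNgt leqnSn !orbT.
Qed.

(** * The even parts *)

Fixpoint evens k := if k is k'.+1 then k'.*2.+2 :: evens k' else [::].

Lemma mem_evens k x : (x \in evens k) = [&& ~~ odd x, 0 < x & x <= k.*2].
Proof. elim: k => [|k IH] /=; rewrite ?inE ?in_nil ?IH; lia. Qed.

Lemma sumn_evens k : sumn (evens k) = k * k.+1.
Proof. elim: k => //= k ->; lia. Qed.

Lemma size_evens k : size (evens k) = k.
Proof. by elim: k => //= k ->. Qed.

Lemma evens_sorted k : sorted gtn (evens k).
Proof.
elim: k => //= k IH; rewrite (path_sortedE gtn_trans) IH andbT.
by apply/allP=> x; rewrite mem_evens => /and3P[_ _ xk] /=; lia.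
Qed.

(** Distinct even numbers closed downwards are determined by their number:
    by induction the tail is [2, ..., 2 * size u], and closedness leaves no gap
    for the head. *)
Lemma closed_evens u :
  sorted gtn u -> all (fun x => ~~ odd x && (0 < x)) u ->
  (forall x y, x \in u -> 0 < y -> ~~ odd y -> y < x -> y \in u) ->
  u = evens (size u).
Proof.
elim: u => //= x u IH; rewrite (path_sortedE gtn_trans) => /andP[xu su].
case/andP=> /andP[x_even x0] all_u clo.
have eu : u = evens (size u).
  apply: IH => // y z yu z0 z_even zy.
  have := clo y z; rewrite !inE yu orbT => /(_ isT z0 z_even zy).
  by case/predU1P=> [zx|//]; have /= := allP xu _ yu; lia.
congr (_ :: _) => //.
have mem_u y : y \in u = [&& ~~ odd y, 0 < y & y <= (size u).*2].
  by rewrite eu mem_evens -eu.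
have x_notin : x \notin u by apply/negP=> /(allP xu) /=; rewrite ltnn.
have := clo x (size u).*2.+2 (mem_head _ _) isT.
rewrite inE mem_u /= odd_double /= => /(_ isT).
move: x_notin; rewrite mem_u; lia.
Qed.

(** * The signed generating polynomials *)

Local Open Scope ring_scope.

Definition odd_gf K m : {poly int} := \sum_(o <- odd_lists K m) 'X^(sumn o).

Lemma odd_gf0 K : odd_gf K 0 = 1.
Proof. by rewrite /odd_gf odd_lists0 big_seq1 expr0. Qed.

Lemma odd_gf_largest K m :
  odd_gf K.+1 m.+1 = odd_gf K m.+1 + 'X^(K.*2.+1) * odd_gf K.+1 m.
Proof.
rewrite /odd_gf odd_listsSS big_cat big_map mulr_sumr; congr (_ + _).
by apply: eq_bigr => o _; rewrite -exprD.
Qed.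

(** Either the part [1] occurs and can be deleted, or all [m+1] parts are at
    least [3] and each can be lowered by [2]. This is the second Pascal rule
    for Gaussian binomial coefficients, which follows by induction from the
    first, [odd_gf_largest]. *)
Lemma odd_gf_smallest K m :
  odd_gf K.+1 m.+1 = 'X * odd_gf K.+1 m + 'X^(m.*2.+2) * odd_gf K m.+1.
Proof.
elim: K m => [|K IHK] m.
  by rewrite odd_gf_largest /odd_gf big_nil mulr0 addr0 add0r.
elim: m => [|m IHm].
  rewrite odd_gf_largest {1}IHK [in RHS]odd_gf_largest !odd_gf0.
  rewrite !doubleS !exprS; ring.
rewrite odd_gf_largest {1}IHK {1}IHm.
rewrite (odd_gf_largest K m.+1) (odd_gf_largest K.+1 m).
rewrite !doubleS !exprS; ring.
Qed.

(** The contribution to [W_d] of the partitions with exactly [k] even parts,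
    hence [d - 2k] odd parts and [d - k] parts in all. *)
Definition nu_term (d k : nat) : {poly int} :=
  if (k.*2 <= d)%N
  then (-1) ^+ (d - k) * 'X^(k * k.+1)%N * odd_gf k.+1 (d - k.*2) else 0.

Lemma nu_term_low d k : (d < k.*2)%N -> nu_term d k = 0.
Proof. by move=> dk; rewrite /nu_term leqNgt dk. Qed.

Lemma nu_termE k m :
  nu_term (k.*2 + m) k =
    (-1) ^+ (k + m) * 'X^(k * k.+1)%N * odd_gf k.+1 m.
Proof.
rewrite /nu_term leq_addr addKn; congr (_ ^+ _ * _ * _).
by rewrite -addnn -addnA addKn.
Qed.

Lemma nu_term0 d : nu_term d 0 = (-1) ^+ d * 'X^d.
Proof.
rewrite (nu_termE 0 d) mulr1; congr (_ * _).
elim: d => [|d IHd]; first by rewrite odd_gf0.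
by rewrite odd_gf_smallest IHd /odd_gf big_nil mulr0 addr0 exprS.
Qed.

(** The partitions with even parts [2, ..., 2k+2] and weight [d+3] are of three
    kinds: without [2k+3], where deleting [2k+2] leaves all odd parts at most
    [2k+1]; with [2k+3] and [1], where one copy of each is deleted; with [2k+3]
    and without [1], where [2k+3] and [2k+2] are deleted and the other odd
    parts lowered by 2. The first two summands are consecutive terms of one
    sequence with opposite signs, so they telescope in the sum over [k]. *)
Lemma nu_term_rec d k :
  nu_term d.+3 k.+1 = - 'X^(k.*2.+2) * nu_term d.+1 k
                      + 'X^(k.+1.*2.+2) * nu_term d.+1 k.+1
                      + 'X^(d.*2 + 5) * nu_term d k.
Proof.
have [dk|dk] := leqP k.*2 d.+1; last first.
  by rewrite !nu_term_low ?mulr0 ?addr0 //; lia.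
have kk : (k.+1 * k.+2 = k * k.+1 + (k.*2.+2))%N by lia.
have [m dE] : exists m, d.+1 = (k.*2 + m)%N by exists (d.+1 - k.*2)%N; lia.
have -> : d.+3 = (k.+1.*2 + m)%N by lia.
rewrite nu_termE kk [in nu_term d.+1 k]dE nu_termE.
(* [m] is the number of odd parts. The summand for partitions with [2k+3] and
   [1] vanishes if [m < 2], the one for [2k+3] without [1] if [m = 0]. *)
case: m dE => [|[|m]] dE.
- rewrite [nu_term d k]nu_term_low ?[nu_term d.+1 _]nu_term_low; try lia.
  rewrite !odd_gf0 !(addn0, addSn, exprS, exprD); ring.
- have -> : d = (k.*2 + 0)%N by lia.
  rewrite nu_termE [nu_term _ k.+1]nu_term_low; last by lia.
  rewrite odd_gf_largest !odd_gf0.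
  rewrite !(addn0, addn1, addSn, addnS, doubleS, exprS, exprD).
  rewrite -[(k.*2).*2]addnn !exprD; ring.
have -> : d = (k.*2 + m.+1)%N by lia.
have -> : ((k.*2 + m.+1).+1 = k.+1.*2 + m)%N by lia.
rewrite !nu_termE kk odd_gf_largest (odd_gf_smallest k.+1 m).
rewrite doubleD !(addnS, addSn, doubleS, exprS, exprD).
rewrite -[(k.*2).*2]addnn !exprD; ring.
Qed.

Lemma sum_nu_term_rec d N : (d < N)%N ->
  \sum_(k < N.+1) nu_term d.+3 k = 'X^(d.*2 + 5) * \sum_(k < N) nu_term d k.
Proof.
move=> dN; rewrite big_ord_recl /=.
under eq_bigr do rewrite /bump /= add1n nu_term_rec.
rewrite big_split /= -mulr_sumr addrA; set S := (X in _ + X + _).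
(* [S] telescopes; its lower end cancels the term of the partition into [d+3]
   ones, the only one of weight [d+3] without even parts, and its upper end is
   zero because weight [d+1] is too low for [N] even parts. *)
suff -> : nu_term d.+3 0 + S = 0 by rewrite add0r.
have -> : S = 'X^(N.*2.+2) * nu_term d.+1 N - 'X^2 * nu_term d.+1 0.
  rewrite /S -(big_mkord xpredT (fun k =>
    - 'X^(k.*2.+2) * nu_term d.+1 k + 'X^(k.+1.*2.+2) * nu_term d.+1 k.+1)).
  have := telescope_sumr (fun k => 'X^(k.*2.+2) * nu_term d.+1 k) (leq0n N).
  rewrite double0 => <-; apply: eq_bigr => k _; ring.
rewrite [nu_term _ N]nu_term_low; last by lia.
rewrite !nu_term0 !exprS; ring.
Qed.

Lemma sum_nu_term j N :
  [/\ (3 * j < N)%N -> \sum_(k < N) nu_term (3 * j) k = 'X^(3 * j ^ 2 + 2 * j),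
      (3 * j + 1 < N)%N ->
        \sum_(k < N) nu_term (3 * j + 1) k = - 'X^(3 * j ^ 2 + 4 * j + 1)
    & (3 * j + 2 < N)%N -> \sum_(k < N) nu_term (3 * j + 2) k = 0].
Proof.
elim: j N => [|j IH] N.
  split; rewrite ?muln0 ?add0n; case: N => // N.
  - move=> _; rewrite big_ord_recl big1 => [|i _]; last by rewrite nu_term_low.
    by rewrite nu_term0 mulr1 addr0.
  - move=> _; rewrite big_ord_recl big1 => [|i _]; last by rewrite nu_term_low.
    rewrite nu_term0; ring.
  case: N => // N _; rewrite 2!big_ord_recl big1 => [|i _]; last first.
    by rewrite nu_term_low.
  rewrite /= /bump /= nu_term0 (nu_termE 1 0) odd_gf0; ring.
have [E0 E1 E2] : [/\ 3 * j.+1 = (3 * j).+3, 3 * j.+1 + 1 = (3 * j + 1).+3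
    & 3 * j.+1 + 2 = (3 * j + 2).+3]%N by split; lia.
case: N => [//|N]; have [I0 I1 I2] := IH N.
rewrite E1 E2 E0; split=> dN.
- rewrite sum_nu_term_rec ?I0 -?exprD; try lia; congr ('X^_); lia.
- rewrite sum_nu_term_rec ?I1 ?mulrN -?exprD; try lia; congr (- 'X^_); lia.
- by rewrite sum_nu_term_rec ?I2 ?mulr0 //; lia.
Qed.

Local Close Scope ring_scope.

(** * The partitions counted by nu *)

Definition evenb := predC odd.

Definition weight (s : seq nat) := count odd s + (count evenb s).*2.

Definition nu_partition n s :=
  [&& is_partition n s, even_parts_distinct s & smaller_evens_occur s].

Lemma weight_le_sumn s : all (fun m => 0 < m) s -> weight s <= sumn s.
Proof.
rewrite /weight; elim: s => //= x s IH /andP[x0 /IH].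
by case: (boolP (odd x)); rewrite /evenb /=; lia.
Qed.

Lemma sumn_even_odd n s :
  is_partition n s -> n = sumn (filter evenb s) + sumn (filter odd s).
Proof.
case/and3P=> _ _ /eqP <-.
by rewrite addnC -sumn_cat (perm_sumn (permEl (perm_filterC odd s))).
Qed.

Lemma nu_evens n s : nu_partition n s -> filter evenb s = evens (count evenb s).
Proof.
case/and3P=> /and3P[s_sorted s_pos _] s_uniq /smaller_evens_occurP s_clo.
rewrite -size_filter; apply: closed_evens.
- rewrite gtn_sorted_uniq_geq (sorted_filter geq_trans) // andbT.
  exact: s_uniq.
- by rewrite all_filter; apply: sub_all s_pos => x /= ->; case: odd.
- move=> x y; rewrite !mem_filter => /andP[_ xs] y0 y_even yx.
  by rewrite /evenb /= y_even (s_clo x).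
Qed.

(** With [k] even parts, an odd part above [2k+1] would force the even number
    [2k+2] below it to be a part, although the even parts are [2, ..., 2k]. *)
Lemma nu_odds n s : nu_partition n s ->
  filter odd s \in odd_lists (count evenb s).+1 (count odd s).
Proof.
move=> nu_s; have evE := nu_evens nu_s.
case/and3P: nu_s => /and3P[s_sorted s_pos _] _ /smaller_evens_occurP s_clo.
rewrite mem_odd_lists (sorted_filter geq_trans) // filter_all size_filter eqxx.
rewrite andbT /=; apply/allP=> x; rewrite mem_filter => /andP[x_odd xs] /=.
rewrite ltnNge; apply/negP=> x_big.
have : (count evenb s).*2.+2 \in evens (count evenb s).
  rewrite -evE mem_filter /evenb /= odd_double /=.
  apply: (s_clo x) => //=; first by rewrite odd_double.
  rewrite ltn_neqAle -doubleS x_big andbT.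
  by move: x_odd; apply: contraL => /eqP<-; rewrite odd_double.
by rewrite mem_evens; lia.
Qed.

Lemma nu_partition_eq n k s t :
  nu_partition n s -> nu_partition n t ->
  count evenb s = k -> count evenb t = k ->
  filter odd s = filter odd t -> s = t.
Proof.
move=> nu_s nu_t ks kt st.
apply: (sorted_eq geq_trans geq_anti).
- by case/and3P: nu_s => /and3P[].
- by case/and3P: nu_t => /and3P[].
rewrite -(perm_filterC odd s) perm_sym -(perm_filterC odd t) st -/evenb.
by rewrite (nu_evens nu_s) (nu_evens nu_t) ks kt.
Qed.

(** The partition is recovered by sorting the union: every even number below an
    odd part at most [2k+1] is at most [2k]. *)
Lemma nu_partition_of k m o : o \in odd_lists k.+1 m ->
  exists s, [/\ nu_partition (k * k.+1 + sumn o) s, count evenb s = k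
              & filter odd s = o].
Proof.
rewrite mem_odd_lists => /and4P[o_sorted o_odd o_small _].
have ev_o : filter evenb o = [::].
  by apply/eqP; rewrite -(negbK (_ == _)) -has_filter has_predC negbK.
have ev_all : all evenb (evens k).
  by apply/allP=> x; rewrite mem_evens => /andP[].
have odd_ev : filter odd (evens k) = [::].
  apply/eqP; rewrite -(negbK (_ == _)) -has_filter; apply/hasPn=> x.
  by move/(allP ev_all).
have ev_sorted : sorted geq (evens k).
  by have := evens_sorted k; rewrite gtn_sorted_uniq_geq => /andP[].
have evE : filter evenb (sort geq (evens k ++ o)) = evens k.
  rewrite (filter_sort geq_total geq_trans) filter_cat ev_o cats0.
  by rewrite (all_filterP ev_all) (sorted_sort geq_trans).
exists (sort geq (evens k ++ o)); split.
- apply/and3P; split; last 1 first.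
  + apply/smaller_evens_occurP => x y; rewrite !mem_sort !mem_cat !mem_evens.
    move=> xs y0 y_even yx; rewrite y_even y0 /=; apply/orP; left.
    case/orP: xs => [|/(allP o_small)] /=; lia.
  + apply/and3P; split; first exact: (sort_sorted geq_total).
      rewrite all_sort all_cat; apply/andP; split.
        by apply/allP=> x; rewrite mem_evens => /and3P[].
      by apply: sub_all o_odd => -[].
    by rewrite (perm_sumn (permEl (perm_sort _ _))) sumn_cat sumn_evens.
  + rewrite /even_parts_distinct [filter _ _]evE.
    by have := evens_sorted k; rewrite gtn_sorted_uniq_geq => /andP[].
- by rewrite -size_filter evE size_evens.
rewrite (filter_sort geq_total geq_trans) filter_cat odd_ev.
by rewrite (all_filterP o_odd) (sorted_sort geq_trans).
Qed.

Definition nu_class n k m :=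
  [set p in A_nu n
    | (count evenb (parts p) == k) && (count odd (parts p) == m)].

(** The map sending a partition to its list of odd parts is a bijection, because
    [k] fixes the even parts. *)
Lemma card_nu_class n k m :
  #|nu_class n k m| =
    count (fun o => n == k * k.+1 + sumn o) (odd_lists k.+1 m).
Proof.
rewrite -size_filter cardE -(size_map (fun p => filter odd (parts p))).
apply/perm_size/uniq_perm.
- rewrite map_inj_in_uniq ?enum_uniq // => p q.
  rewrite !mem_enum !inE => /and3P[nu_p /eqP kp _] /and3P[nu_q /eqP kq _] pq.
  exact/parts_inj/(nu_partition_eq nu_p nu_q kp kq pq).
- by rewrite filter_uniq ?odd_lists_uniq.
move=> o; rewrite mem_filter; apply/mapP/andP => [[p]|[/eqP nE oL]].
  rewrite mem_enum !inE => /and3P[nu_p /eqP <- /eqP <-] ->.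
  rewrite -sumn_evens -(nu_evens nu_p) (nu_odds nu_p).
  by rewrite -(@sumn_even_odd n) //; case/and3P: nu_p.
have [s [nu_s ks sE]] := nu_partition_of oL.
rewrite -nE in nu_s.
have [p pE] : exists p : n.-bseq 'I_n.+1, parts p = s.
  by apply: partition_bseq; case/and3P: nu_s.
exists p; rewrite ?pE // mem_enum !inE pE; apply/and3P; split=> //.
  exact/eqP.
by rewrite -size_filter sE; move: oL; rewrite mem_odd_lists => /and4P[].
Qed.

(** * Comparison of coefficients *)

Local Open Scope ring_scope.

Lemma coef_nu_term n k m :
  (nu_term (k.*2 + m) k)`_n = (-1) ^+ (k + m) * #|nu_class n k m|%:R.
Proof.
rewrite nu_termE -mulrA -[(-1) ^+ _ in LHS](rmorph_sign (@polyC int)) coefCM.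
congr (_ * _).
rewrite /odd_gf mulr_sumr coef_sum card_nu_class -sum1_count natr_sum.
rewrite [RHS]big_mkcond /=.
by apply: eq_bigr => o _; rewrite -exprD coefXn; case: eqP.
Qed.

Lemma a_nu_sign n :
  (a_nu_even n)%:Z - (a_nu_odd n)%:Z
    = \sum_(p in A_nu n) (-1) ^+ size p :> int.
Proof.
rewrite (bigID (fun p : n.-bseq 'I_n.+1 => odd (size p))) /= [RHS]addrC.
rewrite [X in _ = X + _](eq_bigr (fun=> 1)); last first.
  by move=> p /andP[_ /negbTE even_p]; rewrite -signr_odd even_p.
rewrite [X in _ = _ + X](eq_bigr (fun=> -1)); last first.
  by move=> p /andP[_ odd_p]; rewrite -signr_odd odd_p.
rewrite !sumr_const mulNrn /a_nu_even /a_nu_odd !cardsE.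
by rewrite !natz.
Qed.

(** The weight of a partition is at most its sum, so the bound [N] on both the
    weight and the number of even parts loses nothing. *)
Lemma sum_A_nu n N : (n <= N)%N ->
  \sum_(p in A_nu n) (-1) ^+ size p
    = (\sum_(d < N.+1) \sum_(k < N.+1) nu_term d k)`_n.
Proof.
move=> nN.
rewrite (partition_big (fun p => inord (weight (parts p)) : 'I_N.+1) xpredT) //.
rewrite coef_sum; apply: eq_bigr => d _.
rewrite (partition_big
  (fun p => inord (count evenb (parts p)) : 'I_N.+1) xpredT) //.
rewrite coef_sum; apply: eq_bigr => k _.
have classE p : p \in A_nu n ->
    (inord (weight (parts p)) == d) && (inord (count evenb (parts p)) == k)
    = ((weight (parts p) == d) && (count evenb (parts p) == k)).
  rewrite inE => /and3P[/and3P[_ p_pos /eqP sum_p] _ _].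
  have := weight_le_sumn p_pos; rewrite sum_p => p_le.
  rewrite -!val_eqE /= !inordK //; move: p_le; rewrite /weight; lia.
have [dk|kd] := ltnP d k.*2.
  rewrite nu_term_low // coef0 big_pred0 // => p.
  apply/negbTE/negP; rewrite -andbA => /andP[/classE-> /andP[/eqP dE /eqP kE]].
  by move: dk; rewrite -dE -kE /weight; lia.
have -> : nu_term d k = nu_term (k.*2 + (d - k.*2)) k by rewrite subnKC.
rewrite coef_nu_term mulr_natr -sumr_const; apply: eq_big => p.
  rewrite [RHS]inE -andbA; case: (boolP (p \in A_nu n)) => [/classE->|//].
  rewrite /weight; lia.
rewrite -andbA => /andP[/classE-> /andP[/eqP dE /eqP kE]].
congr (_ ^+ _); rewrite -dE -kE /weight addnK.
by rewrite -(size_map val p) addnC -(count_predC odd).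
Qed.

Lemma sum_by_three (F : nat -> int) M :
  \sum_(d < 3 * M) F d =
    \sum_(j < M) (F (3 * j)%N + F (3 * j + 1)%N + F (3 * j + 2)%N).
Proof.
elim: M => [|M IH]; first by rewrite muln0 !big_ord0.
have -> : (3 * M.+1)%N = (3 * M).+3 by lia.
by rewrite !big_ord_recr /= IH !addrA addn1 addn2.
Qed.

Lemma sum_indicator (f : nat -> nat) n N : injective f ->
  \sum_(j < N) (n == f j)%:R = [exists j : 'I_N, n == f j]%:R :> int.
Proof.
move=> f_inj; case: existsP => [[j /eqP nE]|no_j].
  rewrite (bigD1 j) //= nE eqxx big1 ?addr0 // => i ij.
  by rewrite (inj_eq f_inj) eq_sym val_eqE (negbTE ij).
by rewrite big1 // => j _; case: eqP => // nE; case: no_j; exists j; apply/eqP.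
Qed.

(** The two quadratic sequences interlace,
    [3j^2+2j < 3j^2+4j+1 < 3(j+1)^2+2(j+1)], so they have no common value. *)
Lemma e_indicators n : e n = (e_plus n)%:R - (e_minus n)%:R.
Proof.
rewrite /e; case: e_plusP => [[j jE]|_]; last by case: e_minus.
case: e_minusP => // -[i iE]; exfalso.
have [ij|ij] := ltnP i j; nia.
Qed.

Theorem theorem4p3 (n : nat) :
  ((a_nu_even n)%:Z = (a_nu_odd n)%:Z + e n)%R.
Proof.
apply/eqP; rewrite addrC -subr_eq a_nu_sign; apply/eqP.
(* A multiple of 3 as the number of weights lets them be grouped by residue. *)
rewrite (@sum_A_nu n (3 * n).+2); last by lia.
have -> : (3 * n).+3 = (3 * n.+1)%N by lia.
rewrite coef_sum.
rewrite (sum_by_three (fun d => (\sum_(k < 3 * n.+1) nu_term d k)`_n)).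
rewrite (eq_bigr (fun j : 'I_n.+1 => (n == 3 * j ^ 2 + 2 * j)%N%:R
                                  - (n == 3 * j ^ 2 + 4 * j + 1)%N%:R)).
  rewrite big_split sumrN /= e_indicators.
  rewrite (sum_indicator n n.+1 (f := fun j => 3 * j ^ 2 + 2 * j)%N);
    last by move=> i j; nia.
  rewrite (sum_indicator n n.+1 (f := fun j => 3 * j ^ 2 + 4 * j + 1)%N) //.
  by move=> i j; nia.
move=> j _; have [sum0 sum1 sum2] := sum_nu_term j (3 * n.+1).
have jn := ltn_ord j.
by rewrite sum0 ?sum1 ?sum2 ?coef0 ?addr0 ?coefN ?coefXn //; lia.
Qed.
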